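(* Let $(X,d,A)$ be a metric pair in which $(X,d)$ is a geodesic space and $A$ is distance minimizing, and let $p\in[1,\infty]$. Then $(\overline{D}_p(X,A),W_p)$ and $(D(X,A),W_p)$ are geodesic spaces.
   Context: A metric on $X$ is a map $d:X\times X\to[0,\infty]$ with $d(x,x)=0$, symmetry and the triangle inequality (infinite distances allowed, $d(x,y)=0$ need not imply $x=y$); a metric pair $(X,d,A)$ is such a space with a closed subset $A$. Write $d(x,A)=\inf_{a\in A}d(x,a)$, $A^\delta=\{x:d(x,A)<\delta\}$. $A$ is distance minimizing if for every $x$ with $d(x,A)<\infty$ there is $a\in A$ with $d(x,a)=d(x,A)$. $\overline{D}(X,A)$ is the set of countable formal sums $\hat\alpha=\sum_{i\in I}x_i$ of points of $X\setminus A$ (repetitions allowed); $D(X,A)$ the finite ones; $0$ the empty sum. A matching of $\hat\alpha=\sum_{i\in I}x_i$, $\hat\beta=\sum_{j\in J}y_j$ is a formal sum $\sum_{k\in K}(x_k,y_{\varphi(k)})+\sum_{i\in I\setminus K}(x_i,z_i)+\sum_{j\in J\setminus\varphi(K)}(w_j,y_j)$ with $K\subset I$, $\varphi$ injective, $z_i,w_j\in A$; its $p$-cost is the $\ell^p$ norm (sup norm if $p=\infty$) of the distances of paired points; $W_p$ is the infimum of $p$-costs. $u_\delta(\alpha)$, $\ell_\delta(\alpha)$ are the restrictions of $\hat\alpha$ to $X\setminus A^\delta$ and to $A^\delta\setminus A$. For $p<\infty$, $\overline{D}_p(X,A)=\{\alpha: |u_\infty(\alpha)|<\infty,\ W_p(\ell_\infty(\alpha),0)<\infty\}$;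 $\overline{D}_\infty(X,A)=\{\alpha:|u_\delta(\alpha)|<\infty\ \forall\delta>0\}$. The length of a path $\gamma:[0,1]\to X$ is $\sup\sum_n d(\gamma(t_{n-1}),\gamma(t_n))$ over partitions of $[0,1]$. A geodesic between $x,y$ with $d(x,y)<\infty$ is a path from $x$ to $y$ of length $d(x,y)$; a geodesic space is one where any two points at finite distance are joined by a geodesic. *)

(* Defs.v *)
From HB Require Import structures.
From mathcomp Require Import all_boot all_order all_algebra.
From mathcomp Require Import all_classical all_reals all_analysis.
Set Implicit Arguments. Unset Strict Implicit. Unset Printing Implicit Defensive.
Import Order.TTheory GRing.Theory Num.Theory.
Local Open Scope classical_set_scope.
Local Open Scope ring_scope.
Local Open Scope ereal_scope.

Definition is_metric {R : realType} {X : Type} (d : X -> X -> \bar R) : Prop :=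
  (forall x y, 0 <= d x y) /\ (forall x, d x x = 0) /\
  (forall x y, d x y = d y x) /\ (forall x y z, d x z <= d x y + d y z).

Definition dist_set {R : realType} {X : Type} (d : X -> X -> \bar R) (x : X)
  (A : set X) : \bar R := ereal_inf [set d x a | a in A].

(* A is closed in the (extended) metric topology: x in the closure of A iff d(x,A) = 0 *)
Definition metric_closed {R : realType} {X : Type} (d : X -> X -> \bar R)
  (A : set X) : Prop := forall x, dist_set d x A = 0 -> A x.

Definition metric_pair {R : realType} {X : Type} (d : X -> X -> \bar R)
  (A : set X) : Prop := is_metric d /\ metric_closed d A.

Definition distance_minimizing {R : realType} {X : Type} (d : X -> X -> \bar R)
  (A : set X) : Prop :=
  forall x, dist_set d x A < +oo -> exists2 a, A a & d x a = dist_set d x A.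

Definition path_continuous {R : realType} {T : Type} (D : T -> T -> \bar R)
  (g : R -> T) : Prop :=
  forall t : R, (0 <= t <= 1)%R -> forall e : R, (0 < e)%R ->
    exists2 eta : R, (0 < eta)%R &
      forall s : R, (0 <= s <= 1)%R -> (`|s - t| < eta)%R -> D (g s) (g t) < e%:E.

Definition path_length {R : realType} {T : Type} (D : T -> T -> \bar R)
  (g : R -> T) : \bar R :=
  ereal_sup [set s | exists (N : nat) (t : nat -> R),
     [/\ t 0%N = 0%R, t N = 1%R, (forall n, (n < N)%N -> (t n <= t n.+1)%R) &
         s = \sum_(n < N) D (g (t n)) (g (t n.+1))]].

(* S : the points of the space (a subset of T); eqv : equality of points
   (for formal sums: equality up to reindexing); D : the distance. *)
Definition is_geodesic {R : realType} {T : Type} (S : set T) (eqv : T -> T -> Prop)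
  (D : T -> T -> \bar R) (a b : T) (g : R -> T) : Prop :=
  [/\ forall t : R, (0 <= t <= 1)%R -> S (g t), path_continuous D g,
      eqv (g 0%R) a, eqv (g 1%R) b & path_length D g = D a b].

Definition geodesic_space {R : realType} {T : Type} (S : set T)
  (eqv : T -> T -> Prop) (D : T -> T -> \bar R) : Prop :=
  forall a b, S a -> S b -> D a b < +oo -> exists g : R -> T, is_geodesic S eqv D a b g.

(* sum_{i in I} x_i with a countable index set I (subset of nat) *)
Record fsum (X : Type) := FSum { fs_idx : set nat ; fs_pt : nat -> X }.

Definition fs_equiv {X : Type} (a b : fsum X) : Prop :=
  exists f : nat -> nat,
    [/\ forall i, fs_idx a i -> fs_idx b (f i),
        forall i j, fs_idx a i -> fs_idx a j -> f i = f j -> i = j,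
        forall j, fs_idx b j -> exists2 i, fs_idx a i & f i = j &
        forall i, fs_idx a i -> fs_pt b (f i) = fs_pt a i].

(* the empty sum 0 (the point function is irrelevant) *)
Definition fs_zero {X : Type} (a : fsum X) : fsum X := FSum set0 (fs_pt a).

Definition in_Dbar {X : Type} (A : set X) (a : fsum X) : Prop :=
  forall i, fs_idx a i -> ~ A (fs_pt a i).

Definition in_D {X : Type} (A : set X) (a : fsum X) : Prop :=
  in_Dbar A a /\ finite_set (fs_idx a).

Definition fs_restr {X : Type} (a : fsum X) (S : set X) : fsum X :=
  FSum (fs_idx a `&` [set i | S (fs_pt a i)]) (fs_pt a).

Definition u_delta {R : realType} {X : Type} (d : X -> X -> \bar R) (A : set X)
  (delta : \bar R) (a : fsum X) : fsum X :=
  fs_restr a [set y | delta <= dist_set d y A].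
Definition l_delta {R : realType} {X : Type} (d : X -> X -> \bar R) (A : set X)
  (delta : \bar R) (a : fsum X) : fsum X :=
  fs_restr a [set y | dist_set d y A < delta /\ ~ A y].

(* sum_{k in K} (x_k, y_phi(k)) + sum_{i in I\K} (x_i, z_i) + sum_{j in J\phi(K)} (w_j, y_j) *)
Record matching (X : Type) :=
  Matching { m_K : set nat ; m_phi : nat -> nat ; m_z : nat -> X ; m_w : nat -> X }.

Definition is_matching {X : Type} (A : set X) (a b : fsum X) (m : matching X) : Prop :=
  [/\ m_K m `<=` fs_idx a,
      forall k, m_K m k -> fs_idx b (m_phi m k),
      forall k k', m_K m k -> m_K m k' -> m_phi m k = m_phi m k' -> k = k',
      forall i, (fs_idx a `\` m_K m) i -> A (m_z m i) &
      forall j, (fs_idx b `\` (m_phi m @` m_K m)) j -> A (m_w m j)].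

Definition matching_cost {R : realType} {X : Type} (d : X -> X -> \bar R)
  (p : \bar R) (a b : fsum X) (m : matching X) : \bar R :=
  let I := fs_idx a in let J := fs_idx b in let x := fs_pt a in let y := fs_pt b in
  let K := m_K m in let phi := m_phi m in let z := m_z m in let w := m_w m in
  match p with
  | r%:E => poweR
      (esum K (fun k => poweR (d (x k) (y (phi k))) r) +
       esum (I `\` K) (fun i => poweR (d (x i) (z i)) r) +
       esum (J `\` (phi @` K)) (fun j => poweR (d (w j) (y j)) r)) (r^-1)%R
  | _ => ereal_sup ([set 0] `|` [set d (x k) (y (phi k)) | k in K]
                    `|` [set d (x i) (z i) | i in I `\` K]
                    `|` [set d (w j) (y j) | j in J `\` (phi @` K)])
  end.

Definition W {R : realType} {X : Type} (d : X -> X -> \bar R) (A : set X)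
  (p : \bar R) (a b : fsum X) : \bar R :=
  ereal_inf [set matching_cost d p a b m | m in is_matching A a b].

Definition in_Dbar_p {R : realType} {X : Type} (d : X -> X -> \bar R) (A : set X)
  (p : \bar R) (a : fsum X) : Prop :=
  in_Dbar A a /\
  match p with
  | +oo => forall delta : R, (0 < delta)%R -> finite_set (fs_idx (u_delta d A delta%:E a))
  | _ => finite_set (fs_idx (u_delta d A +oo a)) /\
         W d A p (l_delta d A +oo a) (fs_zero a) < +oo
  end.

(* Main.v *)
(* The infimum W_p(a, b) is attained. Take an ultrafilter containing all sets of
   almost optimal matchings: each point of a either has an ultrafilter-constant
   partner, or its partners leave every finite subset of b and hence approach A,
   in which case it is matched to a nearest point of A. Moving all matched pairs
   of an optimal matching simultaneously along constant speed geodesics of X, and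
   dropping the points that lie in A, gives a path that is W_p(a, b)-Lipschitz for
   W_p, hence has length W_p(a, b). *)

Require Import Defs.
From HB Require Import structures.
From mathcomp Require Import all_boot all_order all_algebra finmap lra.
From mathcomp Require Import all_classical all_reals all_analysis.
Import Order.TTheory GRing.Theory Num.Theory numFieldNormedType.Exports.
Local Open Scope classical_set_scope.
Local Open Scope ereal_scope.

(** An ultrafilter is closed under finite intersections only, so the cost of the limit matching is
    estimated on each finite family [F] of its pairs, by charging every pair in [F] to a pair of one
    almost optimal matching. The obstacle is injectivity: a pair joining a point of [a] and a point
    of [b] that are both sent to [A] in the limit would have to pay twice. This does not occur,
    because the partner of the point of [b] can be made to avoid [F]. As escaping partners only
    approach [A], a charge may lose a factor [c < 1], which is removed at the end together with the
    defect [e] of near optimality. The other concern is that interpolated sums stay in the space. It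
    rests on the triangle inequality: an intermediate point of the pair [(u k, v k)] has distance at
    most [d (u k) (v k)] plus that of [u k] to [A]. *)

(** * Norms of families of extended nonnegative numbers *)

Definition lpnorm {R : realType} {T : choiceType} (p : \bar R) (S : set T)
    (c : T -> \bar R) : \bar R :=
  match p with
  | r%:E => poweR (esum S (fun k => poweR (c k) r)) r^-1
  | _ => ereal_sup ([set 0] `|` [set c k | k in S])
  end.

Lemma le_poweR {R : realType} (r : R) (x y : \bar R) : (0 <= r)%R ->
  0 <= x -> x <= y -> poweR x r <= poweR y r.
Proof.
move=> r0 x0 xy; apply: gt0_ler_poweR => //; rewrite in_itv/= leey ?andbT//.
exact: le_trans xy.
Qed.

Lemma poweR_invK {R : realType} (r : R) (x : \bar R) : (0 < r)%R -> 0 <= x ->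
  poweR (poweR x r) r^-1 = x.
Proof. by move=> r0 x0; rewrite -poweRrM mulfV ?gt_eqF// poweRe1. Qed.

Lemma poweR_Kinv {R : realType} (r : R) (x : \bar R) : (0 < r)%R -> 0 <= x ->
  poweR (poweR x r^-1) r = x.
Proof. by move=> r0 x0; rewrite -poweRrM mulVf ?gt_eqF// poweRe1. Qed.

Lemma le_esumZl {R : realType} {T : choiceType} (S : set T) (c : T -> \bar R)
    (e : \bar R) : 0 <= e -> (forall k, 0 <= c k) ->
  esum S (fun k => e * c k) <= e * esum S c.
Proof.
move=> e0 c0; apply: ge_ereal_sup => _ [F FS <-].
rewrite -ge0_mule_fsumr//; apply: lee_wpmul2l => //.
by apply: ereal_sup_ubound; exists F.
Qed.

Lemma le_esum_inj {R : realType} {T T' : choiceType} (S : set T) (S' : set T')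
    (f : T -> T') (c : T' -> \bar R) :
  (forall k, 0 <= c k) -> (forall k, S k -> S' (f k)) ->
  (forall k l, S k -> S l -> f k = f l -> k = l) ->
  esum S (fun k => c (f k)) <= esum S' c.
Proof.
move=> c0 fS finj; rewrite -(esum_image S f c)//; last first.
  by move=> k l /set_mem Sk /set_mem Sl; exact: finj.
apply: ereal_sup_le => _ [F [finF FS] <-]; exists F => //; split => //.
by move=> _ /FS[k Sk <-]; exact: fS.
Qed.

Section lpnorm_theory.
Context {R : realType}.
Implicit Type p : \bar R.

Lemma lpnorm_ge0 {T : choiceType} p (S : set T) (c : T -> \bar R) :
  0 <= lpnorm p S c.
Proof.
by case: p => [r| |] /=; [exact: poweR_ge0|apply: ereal_sup_ubound; left..].
Qed.

(** The comparison principle behind all cost estimates: injectivity of [f] ensures that no term on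
    the right pays twice. The factor [e] will be 1, the inverse of a loss [c < 1], or a time
    difference. *)
Lemma le_lpnorm_inj {T T' : choiceType} p (S : set T) (S' : set T')
    (f : T -> T') (c : T -> \bar R) (c' : T' -> \bar R) (e : R) :
  0 < p -> (0 <= e)%R -> (forall k, 0 <= c k) -> (forall k, 0 <= c' k) ->
  (forall k, S k -> S' (f k)) ->
  (forall k l, S k -> S l -> f k = f l -> k = l) ->
  (forall k, S k -> c k <= e%:E * c' (f k)) ->
  lpnorm p S c <= e%:E * lpnorm p S' c'.
Proof.
move=> p0 e0 c0 c'0 fS finj cc'; have ee0 : 0 <= e%:E by rewrite lee_fin.
case: p p0 => [r| |//] p0 /=; last first.
  apply: ge_ereal_sup => _ [->|[k Sk <-]].
    by apply: mule_ge0 => //; apply: ereal_sup_ubound; left.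
  apply: (le_trans (cc' _ Sk)); apply: lee_wpmul2l => //.
  by apply: ereal_sup_ubound; right; exists (f k) => //; exact: fS.
rewrite lte_fin in p0; have r0 := ltW p0.
rewrite -{1}(poweR_invK r e%:E p0 ee0) -poweRM ?poweR_ge0//; last first.
  by apply: esum_ge0 => k _; exact: poweR_ge0.
apply: le_poweR; [by rewrite invr_ge0|by apply: esum_ge0 => k _; exact: poweR_ge0|].
apply: (@le_trans _ _ (esum S (fun k => poweR e%:E r * poweR (c' (f k)) r))).
  apply: le_esum => k Sk; rewrite -poweRM//; apply: le_poweR => //.
  exact: cc'.
apply: (@le_trans _ _ (poweR e%:E r * esum S (fun k => poweR (c' (f k)) r))).
  by apply: le_esumZl => *; exact: poweR_ge0.
apply: lee_wpmul2l; first exact: poweR_ge0.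
by apply: (le_esum_inj S S' f (fun k => poweR (c' k) r)) => // k; exact: poweR_ge0.
Qed.

Lemma le_lpnorm {T : choiceType} p (S : set T) (c c' : T -> \bar R) :
  0 < p -> (forall k, 0 <= c k) -> (forall k, 0 <= c' k) ->
  (forall k, S k -> c k <= c' k) -> lpnorm p S c <= lpnorm p S c'.
Proof.
move=> p0 c0 c'0 cc'; rewrite -[leRHS]mul1e.
by apply: (le_lpnorm_inj p S S id) => // k Sk; rewrite mul1e; exact: cc'.
Qed.

(** Reduces a bound to finite families, the only ones on which an ultrafilter gives simultaneous
    information. *)
Lemma lpnorm_le_finite {T : choiceType} p (S : set T) (c : T -> \bar R) (M : \bar R) :
  0 < p -> 0 <= M -> (forall k, 0 <= c k) ->
  (forall F : set T, finite_set F -> F `<=` S -> lpnorm p F c <= M) ->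
  lpnorm p S c <= M.
Proof.
case: p => [r| |//] p0 M0 c0 FM /=; last first.
  apply: ge_ereal_sup => _ [->//|[k Sk <-]].
  apply: le_trans (FM [set k] (finite_set1 _) _); last by move=> _ ->.
  by apply: ereal_sup_ubound; right; exists k.
rewrite lte_fin in p0; have cr0 k : 0 <= poweR (c k) r by exact: poweR_ge0.
rewrite -(poweR_invK r M p0 M0).
apply: le_poweR; [by rewrite invr_ge0 ltW|by apply: esum_ge0|].
apply: ge_ereal_sup => _ [F [finF FS] <-]; rewrite -esum_fset//.
rewrite -[leLHS](poweR_Kinv r)//; last by apply: esum_ge0.
apply: le_poweR; [exact: ltW|exact: poweR_ge0|exact: FM].
Qed.

Lemma le_lpnorm_pt {T : choiceType} p (S : set T) (c : T -> \bar R) k :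
  0 < p -> (forall k, 0 <= c k) -> S k -> c k <= lpnorm p S c.
Proof.
case: p => [r| |//] p0 c0 Sk /=; last first.
  by apply: ereal_sup_ubound; right; exists k.
rewrite lte_fin in p0; rewrite -{1}(poweR_invK r (c k) p0 (c0 k)).
apply: le_poweR; [by rewrite invr_ge0 ltW|exact: poweR_ge0|].
rewrite -(@esum_set1 _ _ k (fun k => poweR (c k) r)); last exact: poweR_ge0.
by apply: ereal_sup_le => _ [F [finF FS] <-]; exists F => //; split => // _ /FS ->.
Qed.

Lemma lpnorm_support {T : choiceType} (r : R) (S : set T) (c : T -> \bar R) :
  (0 < r)%R -> lpnorm r%:E (S `&` [set k | c k != 0]) c = lpnorm r%:E S c.
Proof.
move=> r0 /=; congr poweR; rewrite esum_mkcondr; apply: eq_esum => k _.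
case: ifPn => //; rewrite notin_setE/= => /negP/negPn/eqP ->.
by rewrite poweR0r ?gt_eqF.
Qed.

(** Only finiteness is at stake, so the crude bound [(x + y)^r <= 2^r (x^r + y^r)], obtained by
    doubling the larger summand, is enough. *)
Lemma lpnorm_ltyD {T : choiceType} (r : R) (S : set T) (c c' : T -> \bar R) :
  (0 < r)%R -> (forall k, 0 <= c k) -> (forall k, 0 <= c' k) ->
  lpnorm r%:E S c < +oo -> lpnorm r%:E S c' < +oo ->
  lpnorm r%:E S (fun k => c k + c' k) < +oo.
Proof.
move=> r0 c0 c'0 /=.
move=> /lty_poweRy; rewrite gt_eqF ?invr_gt0// => /(_ isT) h.
move=> /lty_poweRy; rewrite gt_eqF ?invr_gt0// => /(_ isT) h'.
apply: poweR_lty.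
have pg0 (x : \bar R) : 0 <= poweR x r by exact: poweR_ge0.
apply: (@le_lt_trans _ _ (poweR 2%:E r * esum S (fun k => poweR (c k) r + poweR (c' k) r))).
  apply: le_trans (le_esumZl _ _ _ (pg0 _) _); last by move=> k; exact: adde_ge0.
  apply: le_esum => k _; wlog cc : c c' c0 c'0 {h h'} / c k <= c' k => [wl|].
    have [|/ltW] := leP (c k) (c' k); first exact: wl.
    by rewrite addeC [X in _ * X]addeC; exact: wl.
  apply: (@le_trans _ _ (poweR (2%:E * c' k) r)).
    apply: le_poweR; [exact: ltW|exact: adde_ge0|].
    by rewrite mule_natl mule2n leeD2r.
  by rewrite poweRM//; apply: lee_wpmul2l => //; rewrite leeDr.
rewrite esumD//; apply: lte_mul_pinfty => //.
exact: lte_add_pinfty.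
Qed.

(** Markov's inequality: [n] terms that are at least [e] contribute at least [n * e^r], which
    exceeds the finite sum [M] once [n > M / e^r]. *)
Lemma lpnorm_lty_finite {T : choiceType} (r : R) (S : set T) (c : T -> \bar R) (e : R) :
  (0 < r)%R -> (0 < e)%R -> (forall k, 0 <= c k) ->
  lpnorm r%:E S c < +oo -> finite_set (S `&` [set k | e%:E <= c k]).
Proof.
move=> r0 e0 c0 /= /lty_poweRy; rewrite gt_eqF ?invr_gt0// => /(_ isT) h.
apply: contrapT => inf.
have er0 : (0 < e `^ r)%R by exact: powR_gt0.
set M := esum _ _ in h.
have M0 : 0 <= M by apply: esum_ge0 => k _; exact: poweR_ge0.
have Mfin : M \is a fin_num by rewrite ge0_fin_numE.
pose n := (Num.truncn (fine M / e `^ r)).+1.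
have [B BS nB] := infinite_set_fset n inf.
have : M < M.
  rewrite -{1}(fineK Mfin); apply: (@lt_le_trans _ _ (n%:R * e `^ r)%:E).
    by rewrite lte_fin -ltr_pdivrMr// truncnS_gt.
  apply: esum_ge; exists [set` B]; first by split => // k /BS[].
  rewrite fsbig_finite//= set_fsetK.
  apply: (@le_trans _ _ (\sum_(i <- B) (e `^ r)%:E)).
    rewrite sumEFin lee_fin big_const_seq count_predT iter_addr_0 mulr_natl.
    by apply: ler_wpMn2l => //; exact: ltW.
  rewrite big_seq [leRHS]big_seq; apply: lee_sum => k /BS[_ /= ek].
  by rewrite -poweR_EFin; apply: le_poweR => //; rewrite ?lee_fin ltW.
by rewrite ltxx.
Qed.

End lpnorm_theory.

(** * Matchings as families of pairs over one index set *)

Section matchings.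
Context {X : Type}.
Implicit Types (A : set X) (a b : fsum X) (m : matching X).

(** Points of [A] count as absent, so both sides of a matching become families over the same [P]: a
    point matched to [A] is a pair with one end in [A], and a moving point may enter [A] without
    changing [P]. *)
Definition off_sum A (P : set nat) (u : nat -> X) : fsum X :=
  fs_restr (FSum P u) (~` A).

(* The pairs of a matching of [a] and [b], indexed by a single set: [i.*2] is the
   pair containing the [i]-th point of [a], and [j.*2.+1] the pair containing the
   [j]-th point of [b] when the latter is matched to [A]. *)
Definition m_idx a b m : set nat :=
  [set k | if odd k then (fs_idx b `\` (m_phi m @` m_K m)) k./2
           else fs_idx a k./2].

Definition m_src a m (k : nat) : X := if odd k then m_w m k./2 else fs_pt a k./2.

Definition m_tgt b m (k : nat) : X :=
  if odd k then fs_pt b k./2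
  else if k./2 \in m_K m then fs_pt b (m_phi m k./2) else m_z m k./2.

Lemma half_odd_inj (k l : nat) : odd k = odd l -> k./2 = l./2 -> k = l.
Proof. by move=> o h; rewrite -(odd_double_half k) o h odd_double_half. Qed.

Lemma m_idxE a b m : m_idx a b m =
  (double @` fs_idx a) `|` ((fun j => j.*2.+1) @` (fs_idx b `\` (m_phi m @` m_K m))).
Proof.
apply/seteqP; split=> k; rewrite /m_idx /=.
  case: ifPn => ok kI; [right|left]; exists k./2 => //.
    by rewrite -[RHS](odd_double_half k) ok.
  by rewrite -[RHS](odd_double_half k) (negbTE ok).
move=> [[i Ii <-]|[j Jj <-]]; first by rewrite odd_double doubleK.
by rewrite /= odd_double /= uphalf_double.
Qed.

Lemma m_idx_finite a b m : finite_set (fs_idx a) -> finite_set (fs_idx b) ->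
  finite_set (m_idx a b m).
Proof.
move=> fa fb; rewrite m_idxE finite_setU; split; apply: finite_image => //.
exact: finite_setD.
Qed.

(** The odd pairs have their source in [A], so [off_sum] discards them and only the doubled indices
    of [a] remain. *)
Lemma fs_equiv_src A a b m : in_Dbar A a -> is_matching A a b m ->
  fs_equiv a (off_sum A (m_idx a b m) (m_src a m)).
Proof.
move=> aA [_ _ _ _ wA]; exists double; split=> [i Ii|i j _ _|k []|i Ii] /=.
- by split; rewrite /m_idx /m_src /= odd_double doubleK//; exact: aA.
- exact: double_inj.
- rewrite /m_idx /m_src /=; case: ifPn => ok Ik.
    by move=> []; exact: wA.
  by move=> _; exists k./2 => //; rewrite -[RHS](odd_double_half k) (negbTE ok).
- by rewrite /m_src odd_double doubleK.
Qed.

Lemma fs_equiv_tgt A a b m : in_Dbar A b -> is_matching A a b m ->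
  fs_equiv b (off_sum A (m_idx a b m) (m_tgt b m)).
Proof.
move=> bA [KI phiJ phi_inj zA _].
pose inv j := xget 0%N [set i | m_K m i /\ m_phi m i = j].
have invP j : (m_phi m @` m_K m) j -> m_K m (inv j) /\ m_phi m (inv j) = j.
  by move=> [i Ki ij]; apply: (@xgetI _ 0%N [set i | m_K m i /\ m_phi m i = j] i).
(* [g j] is the pair containing the [j]-th point of [b]: the even pair of its partner if there is
   one, otherwise its own odd pair. *)
pose g j := if j \in m_phi m @` m_K m then (inv j).*2 else j.*2.+1.
have gpt j : fs_idx b j -> m_tgt b m (g j) = fs_pt b j.
  move=> Jj; rewrite /g; case: ifPn => [/set_mem /invP[Ki ij]|nj].
    by rewrite /m_tgt odd_double doubleK mem_set// ij.
  by rewrite /m_tgt /= odd_double /= uphalf_double.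
exists g; split=> [j Jj|j j' Jj Jj'|k [] /= Ik kA|j Jj] /=.
- split; last by rewrite /= gpt//; exact: bA.
  rewrite /g; case: ifPn => [/set_mem /invP[Ki ij]|]; rewrite /m_idx /=.
    by rewrite odd_double doubleK; exact: KI.
  by rewrite notin_setE /= odd_double /= uphalf_double.
- rewrite /g; case: ifPn => [/set_mem /invP[_ ij]|_];
    case: ifPn => [/set_mem /invP[_ ij']|_].
  + by move=> /double_inj E; rewrite -ij -ij' E.
  + by move=> /(congr1 odd); rewrite /= !odd_double.
  + by move=> /(congr1 odd); rewrite /= !odd_double.
  + by move=> [] /double_inj.
- move: Ik kA; rewrite /m_idx /m_tgt /=; case: ifPn => [ok [Jk nk] _|ok Ik].
    exists k./2 => //; rewrite /g memNset//.
    by rewrite -[RHS](odd_double_half k) ok.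
  case: ifPn => [/set_mem Kk _|nK []]; last first.
    by apply: zA; split => //; rewrite notin_setE in nK.
  exists (m_phi m k./2); first exact: phiJ.
  have im : (m_phi m @` m_K m) (m_phi m k./2) by exists k./2.
  rewrite /g mem_set//; have [Ki /phi_inj ->//] := invP _ im.
  by rewrite -[RHS](odd_double_half k) (negbTE ok).
- exact: gpt.
Qed.

Context {R : realType} (d : X -> X -> \bar R).
Hypothesis d0 : forall x y, 0 <= d x y.

Lemma matching_costE p a b m : 0 < p -> m_K m `<=` fs_idx a ->
  matching_cost d p a b m =
  lpnorm p (m_idx a b m) (fun k => d (m_src a m k) (m_tgt b m k)).
Proof.
move=> p0 KI.
have src_even i : m_src a m i.*2 = fs_pt a i by rewrite /m_src odd_double doubleK.
have tgt_even i : m_tgt b m i.*2 =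
    if i \in m_K m then fs_pt b (m_phi m i) else m_z m i.
  by rewrite /m_tgt odd_double doubleK.
have src_odd j : m_src a m j.*2.+1 = m_w m j.
  by rewrite /m_src /= odd_double /= uphalf_double.
have tgt_odd j : m_tgt b m j.*2.+1 = fs_pt b j.
  by rewrite /m_tgt /= odd_double /= uphalf_double.
case: p p0 => [r| |//] p0 /=; last first.
  congr ereal_sup; apply/seteqP; split=> x.
    move=> [[[->|[k Kk <-]]|[i [Ii nK] <-]]|[j Jj <-]].
    - by left.
    - right; exists k.*2; last by rewrite src_even tgt_even mem_set.
      by rewrite m_idxE; left; exists k => //; exact: KI.
    - right; exists i.*2; last by rewrite src_even tgt_even memNset.
      by rewrite m_idxE; left; exists i.
    - right; exists j.*2.+1; last by rewrite src_odd tgt_odd.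
      by rewrite m_idxE; right; exists j.
  move=> [->|[k]]; first by left; left; left.
  rewrite m_idxE => -[[i Ii <-]|[j Jj <-]] <-.
    rewrite src_even tgt_even; case: ifPn => [/set_mem Ki|].
      by left; left; right; exists i.
    by rewrite notin_setE => nK; left; right; exists i.
  by rewrite src_odd tgt_odd; right; exists j.
congr poweR; have pow0 (x : \bar R) : 0 <= poweR x r by exact: poweR_ge0.
(* Odd indices carry the terms of the unmatched points of [b]; the even ones are split further along
   [m_K m]. *)
rewrite [RHS](esumID [set k | ~~ odd k])//.
have -> : m_idx a b m `&` [set k | ~~ odd k] = double @` fs_idx a.
  rewrite m_idxE; apply/seteqP; split=> [k [[//|[j _ <-]]]|k [i Ii <-]].
    by rewrite /= odd_double.
  by split; [left; exists i|rewrite /= odd_double].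
have -> : m_idx a b m `&` ~` [set k | ~~ odd k] =
    (fun j => j.*2.+1) @` (fs_idx b `\` (m_phi m @` m_K m)).
  rewrite m_idxE; apply/seteqP; split=> [k [[[i _ <-]|//]]|k [j Jj <-]].
    by rewrite /= odd_double.
  by split; [right; exists j|rewrite /= odd_double].
rewrite (esum_image (fs_idx a) double); last by move=> ? ? _ _; exact: double_inj.
rewrite (esum_image _ (fun j => j.*2.+1)); last first.
  by move=> ? ? _ _ [] /double_inj.
rewrite (esumID (m_K m) (fs_idx a))//; congr (_ + _ + _).
- rewrite setIidr//; apply: eq_esum => k Kk.
  by rewrite src_even tgt_even mem_set.
- by apply: eq_esum => i [_ nK]; rewrite src_even tgt_even memNset.
- by apply: eq_esum => j _; rewrite src_odd tgt_odd.
Qed.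

(* Two sums indexed by a common set, up to points of [A], form a matching. *)
Lemma W_le_lpnorm A p a b (P : set nat) (u v : nat -> X) : 0 < p ->
  fs_equiv a (off_sum A P u) -> fs_equiv b (off_sum A P v) ->
  W d A p a b <= lpnorm p P (fun k => d (u k) (v k)).
Proof.
move=> p0 [f [/= fP finj fsurj fpt]] [g [/= gP ginj gsurj gpt]].
(* Points of [a] and [b] sitting at the same index of [P] are paired; a point whose other end lies
   in [A] is matched to that end. *)
pose K := [set i | fs_idx a i /\ ~ A (v (f i))].
pose phi i := xget 0%N [set j | fs_idx b j /\ g j = f i].
have phiP i : K i -> fs_idx b (phi i) /\ g (phi i) = f i.
  move=> [Ii vA]; have [Pi _] := fP _ Ii; have [j Jj ji] := gsurj (f i) (conj Pi vA).
  exact: (@xgetI _ 0%N [set j | fs_idx b j /\ g j = f i] j).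
pose m := Matching K phi (fun i => v (f i)) (fun j => u (g j)).
have im j i : fs_idx a i -> fs_idx b j -> g j = f i -> (phi @` K) j.
  move=> Ii Jj ji; have Ki : K i by split=> //; rewrite -ji; have [] := gP _ Jj.
  exists i => //; have [Jp pE] := phiP _ Ki; apply: ginj => //.
  by rewrite pE.
have mm : is_matching A a b m.
  split=> /=.
  - by move=> i [].
  - by move=> i /phiP[].
  - move=> k l Kk Kl kl; have [_ Ek] := phiP _ Kk; have [_ El] := phiP _ Kl.
    by case: Kk Kl => Ik _ [Il _]; apply: finj => //; rewrite -Ek -El kl.
  - by move=> i [Ii nK]; apply: contrapT => vA; apply: nK.
  - move=> j [Jj nj]; apply: contrapT => uA; apply: nj.
    have [Pj _] := gP _ Jj; have [i Ii ij] := fsurj (g j) (conj Pj uA).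
    exact: (im _ i).
apply: (@le_trans _ _ (matching_cost d p a b m)).
  by apply: ereal_inf_lbound; exists m.
rewrite matching_costE//; last by move=> i [].
rewrite -[leRHS]mul1e.
(* Every pair of [m] is sent to its index in [P]. An even and an odd pair cannot collide there: by
   [im] the point of [b] in the odd pair would then be matched. *)
apply: (le_lpnorm_inj p _ _ (fun k => if odd k then g k./2 else f k./2)) => //.
- move=> k; rewrite /m_idx /=; case: ifPn => _ => [[Jk _]|Ik].
    by have [] := gP _ Jk.
  by have [] := fP _ Ik.
- move=> k l; rewrite /m_idx /=.
  case: ifPn => ok; case: ifPn => ol.
  + by move=> [Jk _] [Jl _] /(ginj _ _ Jk Jl); apply: half_odd_inj; rewrite ok ol.
  + by move=> [Jk nk] Il E; case: nk; exact: (im _ l./2).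
  + by move=> Ik [Jl nl] E; case: nl; exact: (im _ k./2).
  + move=> Ik Il /(finj _ _ Ik Il); apply: half_odd_inj.
    by rewrite (negbTE ok) (negbTE ol).
- move=> k; rewrite /m_idx /m_src /m_tgt /= mul1e; case: ifPn => _ => [[Jk _]|Ik].
    by rewrite -gpt.
  rewrite -fpt//; case: ifPn => [/set_mem Kk|//].
  by have [Jp <-] := phiP _ Kk; rewrite -(gpt _ Jp).
Qed.

End matchings.

(** * Distance to [A] and existence of optimal matchings *)

Section optimal_matching.
Context {R : realType} {X : Type} (d : X -> X -> \bar R) (A : set X).
Hypotheses (d0 : forall x y, 0 <= d x y) (dxx : forall x, d x x = 0)
  (dC : forall x y, d x y = d y x)
  (dT : forall x y z, d x z <= d x y + d y z)
  (Aclosed : metric_closed d A) (Amin : distance_minimizing d A).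

Local Notation dA x := (dist_set d x A).

Lemma dist_set_ge0 x : 0 <= dA x.
Proof. by apply: le_ereal_inf_tmp => _ [a _ <-]. Qed.

Lemma dist_set_le x a : A a -> dA x <= d x a.
Proof. by move=> Aa; apply: ereal_inf_lbound; exists a. Qed.

Lemma dist_set_eq0 x : (dA x == 0) = (x \in A).
Proof.
apply/eqP/idP => [/Aclosed/mem_set//|/set_mem Ax].
by apply: le_anti; rewrite dist_set_ge0 -(dxx x) dist_set_le.
Qed.

Lemma dist_set_triangle x y : dA x <= d x y + dA y.
Proof.
have [|] := ltP (dA y) +oo; last first.
  by rewrite leye_eq => /eqP ->; rewrite addey ?leey// gt_eqF// (lt_le_trans _ (d0 _ _)).
by move=> /Amin[a Aa <-]; apply: le_trans (dT _ _ _); exact: dist_set_le.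
Qed.

Lemma exists_nearest : exists nearest : X -> X,
  forall x, dA x < +oo -> A (nearest x) /\ d x (nearest x) = dA x.
Proof.
suff /boolp.choice[f fP] : forall x, exists a, dA x < +oo -> A a /\ d x a = dA x.
  by exists f.
move=> x; have [/Amin[a Aa da]|_] := ltP (dA x) +oo; first by exists a.
by exists x.
Qed.

(** By the triangle inequality [e = (1 - c) * dA x] works, and it is positive because [A] is closed.
    If [dA x] is infinite, then [x] is infinitely far from every [y] at finite distance from [A]. *)
Lemma far_from_near (c : R) x : (0 < c < 1)%R -> ~ A x ->
  exists2 e : R, (0 < e)%R & forall y, dA y < e%:E -> c%:E * dA x <= d x y.
Proof.
move=> /andP[c0 c1] nAx.
have : 0 < dA x by rewrite lt_neqAle dist_set_ge0 andbT eq_sym dist_set_eq0 memNset.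
case E : (dA x) => [D| |] // D0.
  rewrite lte_fin in D0; exists ((1 - c) * D)%R; first by rewrite mulr_gt0// subr_gt0.
  move=> y ye; have := dist_set_triangle x y; rewrite E.
  have := d0 x y; case: (d x y) => [dxy| |] //= _; last by rewrite leey.
  move: ye; have := dist_set_ge0 y; case: (dA y) => [dy| |] //= _.
  rewrite lte_fin -EFinD -EFinM !lee_fin mulrBl mul1r => h1 h2.
  rewrite -(lerD2r dy) (le_trans _ h2)// -lerBrDl.
  exact: ltW.
exists 1%R => // y y1; have := dist_set_triangle x y; rewrite E leye_eq.
have := d0 x y; case: (d x y) => [dxy| |] // _; last by rewrite leey.
by move: y1; case: (dA y).
Qed.

(** The common feature of the finite sums and of all the spaces with exponent [p]: partners that
    leave every finite set must approach [A]. *)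
Definition vanishing (a : fsum X) := forall e : R, (0 < e)%R ->
  finite_set (fs_idx a `&` [set i | e%:E <= dA (fs_pt a i)]).

Lemma W_ge0 p a b : 0 < p -> 0 <= W d A p a b.
Proof.
move=> p0; apply: le_ereal_inf_tmp => _ [m [KI _ _ _ _] <-].
by rewrite matching_costE//; exact: lpnorm_ge0.
Qed.

(* Limit of almost optimal matchings along an ultrafilter: a point whose
   partners escape every finite set is matched to [A] in the limit, which costs
   no more since the escaping partners approach [A]. *)
Lemma optimal_matching p a b : 0 < p -> in_Dbar A a -> in_Dbar A b ->
  vanishing a -> vanishing b -> W d A p a b < +oo ->
  exists2 m, is_matching A a b m & matching_cost d p a b m <= W d A p a b.
Proof.
have [nearest nearestP] := exists_nearest.
move=> p0 aA bA va vb Wfin; set L := W d A p a b.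
pose near_opt (e : R) := [set m | is_matching A a b m /\
  matching_cost d p a b m <= L + e%:E].
have L0 : 0 <= L by exact: W_ge0.
have Lfin : L \is a fin_num by rewrite ge0_fin_numE.
have FF : ProperFilter (filter_from [set e : R | (0 < e)%R] near_opt).
  apply: filter_from_proper; last first.
    by move=> e e0; have [_ [m mm <-] /ltW me] := lb_ereal_inf_adherent e0 Lfin; exists m.
  apply: filter_from_filter; first by exists 1%R => /=.
  move=> e f e0 f0; exists (Num.min e f); first by rewrite /= lt_min e0 f0.
  move=> m [mm me]; split; split => //; apply: (le_trans me); rewrite leeD2l// lee_fin.
    by rewrite ge_min lexx.
  by rewrite ge_min lexx orbT.
have [U [UU FU]] := ultraFilterLemma FF.
have UE e : (0 < e)%R -> U (near_opt e) by move=> e0; apply: FU; exists e.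
have UV : U (is_matching A a b) by apply: filterS (UE 1%R ltr01) => m [].
have UN B : ~ U B -> U (~` B) by have [] := in_ultra_setVsetC B UU.
have Ufin (H : set nat) (B : nat -> set (matching X)) : finite_set H ->
    (forall j, H j -> U (B j)) -> U [set m | forall j, H j -> B j m].
  move=> /finite_fsetP[G ->] GB.
  have h : U (\bigcap_(j in [set` G]) B j) by exact: filter_bigI.
  by apply: filterS h => m mB j Gj; exact: mB.
pose to_ i j := [set m : matching X | m_K m i /\ m_phi m i = j].
pose K := [set i | exists j, U (to_ i j)].
pose phi i := xget 0%N [set j | U (to_ i j)].
have phiP i : K i -> U (to_ i (phi i)).
  by move=> [j Uj]; apply: (@xgetI _ 0%N [set j | U (to_ i j)] j).
pose opt := Matching K phi (nearest \o fs_pt a) (nearest \o fs_pt b).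
pose cost m k := d (m_src a m k) (m_tgt b m k).
have cost0 m k : 0 <= cost m k by exact: d0.
have cost_fin m l : near_opt 1%R m -> m_idx a b m l -> cost m l < +oo.
  move=> [mm mc] ml; have [KI _ _ _ _] := mm; rewrite matching_costE// in mc.
  apply: (@le_lt_trans _ _ (L + 1)); last by rewrite lte_add_pinfty// ltry.
  by apply: (le_trans _ mc); apply: (@le_lpnorm_pt _ _ p _ (cost m)).
(* The factor 1/2 is used for finiteness: a point without a limit partner has finite distance to
   [A], hence a nearest point there. *)
have half_fin (D : \bar R) : (2^-1)%:E * D < +oo -> D < +oo.
  move=> h; rewrite ltNge leye_eq; apply/negP => /eqP DE; move: h.
  by rewrite DE gt0_muley ?ltxx// lte_fin invr_gt0.
have half01 : (0 < 2^-1 :> R)%R && (2^-1 < 1 :> R)%R.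
  by rewrite invr_gt0 ltr0n/= invf_lt1 ?ltr0n// ltr1n.
(* Almost every matching avoids pairing [i] with the finitely many points of [b] at distance at
   least [e] from [A], so its partner is in [A] or close to it. *)
have even_claim i c : (0 < c < 1)%R -> fs_idx a i -> ~ K i ->
    U [set m | is_matching A a b m /\ c%:E * dA (fs_pt a i) <= cost m i.*2].
  move=> c01 Ii nK; have [e e0 eP] := far_from_near c _ c01 (aA _ Ii).
  apply: filterS2 UV (Ufin _ (fun j => ~` to_ i j) (vb e e0) _); last first.
    by move=> j _; apply: UN => Uj; apply: nK; exists j.
  move=> m mm nm; split=> //; have [KI phiJ _ zA _] := mm.
  rewrite /cost /m_src /m_tgt odd_double doubleK.
  case: ifPn => [/set_mem Ki|]; last rewrite notin_setE => nKi.
    apply: eP; rewrite ltNge; apply/negP => eb.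
    by apply: (nm (m_phi m i)) => //; split => //; exact: phiJ.
  apply: (@le_trans _ _ (dA (fs_pt a i))).
    rewrite -[leRHS]mul1e; apply: lee_wpmul2r; first exact: dist_set_ge0.
    by rewrite lee_fin ltW; case/andP: c01.
  by apply: dist_set_le; apply: zA.
(* The symmetric claim, with an additional finite set [G] of pair indices to be avoided by the
   partner of [j]; taking [G = F] below keeps the charging injective. *)
have odd_claim j c (G : set nat) : (0 < c < 1)%R -> finite_set G ->
    fs_idx b j -> ~ (phi @` K) j ->
    U [set m | is_matching A a b m /\ exists l, [/\ m_idx a b m l,
       c%:E * dA (fs_pt b j) <= cost m l &
       l = j.*2.+1 \/ [/\ ~ G l, m_K m l./2 & m_phi m l./2 = j]]].
  move=> c01 Gfin Jj nK; have [e e0 eP] := far_from_near c _ c01 (bA _ Jj).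
  have G'fin : finite_set ((fs_idx a `&` [set i | e%:E <= dA (fs_pt a i)]) `|`
      (half @` G)).
    by rewrite finite_setU; split; [exact: va|exact: finite_image].
  apply: filterS2 UV (Ufin _ (fun i => ~` to_ i j) G'fin _); last first.
    move=> i _; apply: UN => Ui; apply: nK; have Ki : K i by exists j.
    by exists i => //; have [m [[_ <-] [_ <-]]] := filter_ex (filterI Ui (phiP i Ki)).
  move=> m mm nm; split=> //; have [KI phiJ _ zA wA] := mm.
  have [[i Ki ij]|nj] := pselect ((m_phi m @` m_K m) j).
    exists i.*2; rewrite doubleK; split.
    - by rewrite m_idxE; left; exists i => //; exact: KI.
    - rewrite /cost /m_src /m_tgt odd_double doubleK mem_set// ij dC.
      apply: eP; rewrite ltNge; apply/negP => ei.
      by apply: (nm i) => //; left; split => //; exact: KI.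
    - right; split => // Gi; apply: (nm i) => //; right; exists i.*2 => //.
      by rewrite doubleK.
  exists j.*2.+1; split; [by rewrite m_idxE; right; exists j| |by left].
  rewrite /cost /m_src /m_tgt /= odd_double /= uphalf_double dC.
  apply: (@le_trans _ _ (dA (fs_pt b j))).
    rewrite -[leRHS]mul1e; apply: lee_wpmul2r; first exact: dist_set_ge0.
    by rewrite lee_fin ltW; case/andP: c01.
  by apply: dist_set_le; apply: wA.
have afin i : fs_idx a i -> ~ K i -> dA (fs_pt a i) < +oo.
  move=> Ii nK; apply: half_fin.
  have [m [m1 [_ mi]]] := filter_ex (filterI (UE 1%R ltr01) (even_claim i _ half01 Ii nK)).
  apply: (le_lt_trans mi); apply: cost_fin => //.
  by rewrite m_idxE; left; exists i.
have bfin j : fs_idx b j -> ~ (phi @` K) j -> dA (fs_pt b j) < +oo.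
  move=> Jj nK; apply: half_fin.
  have [m [m1 [_ [l [ml mi _]]]]] := filter_ex (filterI (UE 1%R ltr01)
    (odd_claim j _ set0 half01 (finite_set0 _) Jj nK)).
  by apply: (le_lt_trans mi); apply: cost_fin.
have optP : is_matching A a b opt.
  split => /=.
  - by move=> i /phiP Ui; have [m [[KI _ _ _ _] [Ki _]]] := filter_ex (filterI UV Ui); exact: KI.
  - by move=> i /phiP Ui; have [m [[_ KJ _ _ _] [Ki <-]]] := filter_ex (filterI UV Ui); exact: KJ.
  - move=> i j /phiP Ui /phiP Uj ij.
    have [m [[_ _ inj _ _] [[Ki iE] [Kj jE]]]] := filter_ex (filterI UV (filterI Ui Uj)).
    by apply: inj => //; rewrite iE jE.
  - by move=> i [Ii nK]; have [] := nearestP _ (afin _ Ii nK).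
  - by move=> j [Jj nK]; have [] := nearestP _ (bfin _ Jj nK).
exists opt => //; rewrite matching_costE//; last by have [] := optP.
apply: lpnorm_le_finite => // F finF FI.
(* Two independent losses: [c] accounts for partners that are near [A] but not in it, [e] for the
   matching being only almost optimal. *)
apply/lee_mul01Pr => [|c c01]; first exact: lpnorm_ge0.
apply/lee_addgt0Pr => e e0.
(* [good m k l] says that the pair [l] of [m] pays for the limit pair [k]. Either [l] is [k] itself,
   hence in [F], or it lies outside [F] and determines [k] through the point of [b] it contains; so
   different [k] in [F] are charged to different [l]. *)
pose good m k l := [/\ m_idx a b m l, c%:E * cost opt k <= cost m l &
  l = k \/ [/\ ~ F l, odd k, m_K m l./2 & m_phi m l./2 = k./2]].
have Ugood k : F k -> U [set m | is_matching A a b m /\ exists l, good m k l].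
  move=> Fk; move: (FI k Fk); rewrite {1}/m_idx /=; case: ifPn => ok.
    move=> [Jk nK]; apply: filterS (odd_claim _ c F c01 finF Jk nK).
    move=> m [mm [l [ml lc lF]]]; split=> //; exists l; split=> //.
      rewrite /cost /m_src /m_tgt ok /= dC.
      by have [_ ->] := nearestP _ (bfin _ Jk nK).
    case: lF => [->|[nF Kl pl]]; [left|right; split => //].
    by rewrite -[RHS](odd_double_half k) ok.
  move=> Ik; have kE : k = k./2.*2 by rewrite -[LHS](odd_double_half k) (negbTE ok).
  have [Kk|nK] := pselect (K k./2).
    apply: filterS2 UV (phiP _ Kk) => m mm [mK pE]; split => //.
    have [KI _ _ _ _] := mm.
    exists k; split; [|rewrite -[leRHS]mul1e|by left].
      by rewrite /m_idx /= (negbTE ok).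
    rewrite /cost /m_src /m_tgt (negbTE ok) !mem_set//= pE.
    by apply: lee_wpmul2r => //; rewrite lee_fin ltW; case/andP: c01.
  apply: filterS (even_claim _ _ c01 Ik nK) => m [mm mc]; split => //.
  exists k; split; [|rewrite [in leRHS]kE; apply: le_trans mc|by left].
    by rewrite /m_idx /= (negbTE ok).
  rewrite /cost /m_src /m_tgt (negbTE ok) memNset//=.
  by have [_ ->] := nearestP _ (afin _ Ik nK).
have [m [[mm mc] mgood]] := filter_ex (filterI (UE e e0) (Ufin _ _ finF Ugood)).
have [KI _ _ _ _] := mm; rewrite matching_costE// in mc.
apply: le_trans mc; pose s k := xget 0%N (good m k).
have sP k : F k -> good m k (s k).
  by move=> /mgood[_ [l ml]]; exact: (@xgetI _ 0%N (good m k) l).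
have c0 : (0 < c)%R by case/andP: c01.
rewrite -lee_pdivlMl//.
apply: (le_lpnorm_inj p _ _ s) => //.
- by rewrite invr_ge0 ltW.
- by move=> k /sP[].
- move=> k l Fk Fl; have [_ _ kP] := sP _ Fk; have [_ _ lP] := sP _ Fl.
  case: kP lP => [->|[nk ok _ kE]] [->|[nl ol _ lE]] E //.
  + by case: nl; rewrite -E.
  + by case: nk; rewrite E.
  + by apply: half_odd_inj; rewrite ?ok ?ol// -kE -lE E.
- by move=> k /sP[_ ? _]; rewrite lee_pdivlMl.
Qed.

(* For [p = +oo] an optimal matching may pair points of the two sums that both
   approach [A] while staying far apart, and the interpolations would not
   vanish; matching such pairs to [A] instead does not increase the sup norm. *)
Lemma optimal_pairing p a b : 0 < p -> in_Dbar A a -> in_Dbar A b ->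
  vanishing a -> vanishing b -> W d A p a b < +oo ->
  exists (P : set nat) (u v : nat -> X),
  [/\ fs_equiv a (off_sum A P u), fs_equiv b (off_sum A P v),
      lpnorm p P (fun k => d (u k) (v k)) <= W d A p a b,
      finite_set (fs_idx a) -> finite_set (fs_idx b) -> finite_set P &
      p = +oo -> forall k, P k -> d (u k) (v k) <= maxe (dA (u k)) (dA (v k))].
Proof.
move=> p0 aA bA va vb Wfin.
have [m mm mW] := optimal_matching p a b p0 aA bA va vb Wfin.
case: p p0 Wfin mW => [r| |//] p0 Wfin mW.
  exists (m_idx a b m), (m_src a m), (m_tgt b m); split => //.
  - exact: fs_equiv_src.
  - exact: fs_equiv_tgt.
  - by have [KI _ _ _ _] := mm; rewrite -matching_costE.
  - exact: m_idx_finite.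
have [nearest nearestP] := exists_nearest.
have [KI phiJ phi_inj zA wA] := mm; rewrite matching_costE// in mW.
pose cost k := d (m_src a m k) (m_tgt b m k).
have cost0 k : 0 <= cost k by exact: d0.
have costW k : m_idx a b m k -> cost k <= W d A +oo a b.
  by move=> mk; apply: le_trans mW; apply: (@le_lpnorm_pt _ _ _ _ cost).
pose K := m_K m `&` [set k | d (fs_pt a k) (fs_pt b (m_phi m k)) <=
  maxe (dA (fs_pt a k)) (dA (fs_pt b (m_phi m k)))].
have costK i : m_K m i -> d (fs_pt a i) (fs_pt b (m_phi m i)) <= W d A +oo a b.
  move=> Ki; have := costW i.*2; rewrite /cost /m_src /m_tgt odd_double doubleK mem_set//.
  by apply; rewrite m_idxE; left; exists i => //; exact: KI.
(* A pair of [m_K m] that is dropped from [K] is longer than the distances of both its ends to [A],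
   and its own length is at most [W d A +oo a b]. *)
have aW i : (fs_idx a `\` K) i -> dA (fs_pt a i) <= W d A +oo a b.
  move=> [Ii nK]; have [Ki|nKi] := pselect (m_K m i).
    apply: le_trans (costK i Ki); rewrite leNgt; apply/negP => lt.
    by apply: nK; split => //=; rewrite le_max ltW.
  apply: (@le_trans _ _ (d (fs_pt a i) (m_z m i))); first by apply: dist_set_le; exact: zA.
  have := costW i.*2; rewrite /cost /m_src /m_tgt odd_double doubleK memNset//.
  by apply; rewrite m_idxE; left; exists i.
have bW j : (fs_idx b `\` (m_phi m @` K)) j -> dA (fs_pt b j) <= W d A +oo a b.
  move=> [Jj nK]; have [[i Ki ij]|nj] := pselect ((m_phi m @` m_K m) j).
    apply: le_trans (costK i Ki); rewrite leNgt ij; apply/negP => lt.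
    by apply: nK; exists i => //; split => //=; rewrite le_max ij (ltW lt) orbT.
  apply: (@le_trans _ _ (d (m_w m j) (fs_pt b j))).
    by rewrite dC; apply: dist_set_le; exact: wA.
  have := costW j.*2.+1; rewrite /cost /m_src /m_tgt /= odd_double /= uphalf_double.
  by apply; rewrite m_idxE; right; exists j.
pose m' := Matching K (m_phi m) (nearest \o fs_pt a) (nearest \o fs_pt b).
have aN i : (fs_idx a `\` K) i -> A (nearest (fs_pt a i)) /\
    d (fs_pt a i) (nearest (fs_pt a i)) = dA (fs_pt a i).
  by move=> /aW aWi; apply: nearestP; exact: le_lt_trans Wfin.
have bN j : (fs_idx b `\` (m_phi m @` K)) j -> A (nearest (fs_pt b j)) /\
    d (fs_pt b j) (nearest (fs_pt b j)) = dA (fs_pt b j).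
  by move=> /bW bWj; apply: nearestP; exact: le_lt_trans Wfin.
have mm' : is_matching A a b m'.
  split => /=.
  - by move=> i [/KI].
  - by move=> i [/phiJ].
  - by move=> i j [Ki _] [Kj _]; exact: phi_inj.
  - by move=> i /aN[].
  - by move=> j /bN[].
exists (m_idx a b m'), (m_src a m'), (m_tgt b m'); split => //.
- exact: fs_equiv_src.
- exact: fs_equiv_tgt.
- apply: ge_ereal_sup => _ [->|[k + <-]]; first exact: W_ge0.
  rewrite /m_idx /m_src /m_tgt /=; case: ifPn => ok.
    by move=> Jk; rewrite dC; have [_ ->] := bN _ Jk; exact: bW.
  case: ifPn => [/set_mem[Kk _] _|]; first exact: costK.
  rewrite notin_setE => nK Ik; have [_ ->] := aN _ (conj Ik nK).
  exact: aW.
- exact: m_idx_finite.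
- move=> _ k; rewrite /m_idx /m_src /m_tgt /=; case: ifPn => ok.
    by move=> Jk; rewrite dC; have [_ ->] := bN _ Jk; rewrite le_max lexx orbT.
  case: ifPn => [/set_mem[Kk //]|].
  rewrite notin_setE => nK Ik; have [_ ->] := aN _ (conj Ik nK).
  by rewrite le_max lexx.
Qed.

End optimal_matching.

(** * Constant speed geodesics and Lipschitz paths *)

(** Minimal length forces [d (g s) (g t) = f t - f s] for [s <= t], where [f t] is the distance from
    [x] to [g t]. Choosing [tau s] with [f (tau s) = s * d x y] by the intermediate value theorem
    then gives constant speed. *)
Lemma constant_speed_geodesic {R : realType} {X : Type} (d : X -> X -> \bar R) :
  is_metric d -> geodesic_space setT (@eq X) d -> forall x y, d x y < +oo ->
  exists h : R -> X, [/\ h 0%R = x, h 1%R = y &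
    forall s t, (0 <= s <= 1)%R -> (0 <= t <= 1)%R ->
      d (h s) (h t) <= `|s - t|%:E * d x y].
Proof.
move=> [d0 [dxx [dC dT]]] geo x y xy.
have [g [_ gc gx gy glen]] := geo x y I I xy.
have dfin : d x y \is a fin_num by rewrite ge0_fin_numE.
have split3 s t : (0 <= s)%R -> (s <= t)%R -> (t <= 1)%R ->
    d x (g s) + d (g s) (g t) + d (g t) y <= d x y.
  move=> s0 st t1; rewrite -glen; apply: ereal_sup_ubound.
  (* The default value 1 of [nth] supplies the last partition point. *)
  exists 3%N, (nth 1%R [:: 0%R; s; t]); split => //; first by case=> [|[|[|]]].
  by rewrite !big_ord_recr big_ord0 /= add0e gx gy.
pose f t := fine (d x (g t)).
pose e s t := fine (d (g s) (g t)).
have gfin s t : (0 <= s)%R -> (s <= t)%R -> (t <= 1)%R ->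
    [/\ d x (g s) = (f s)%:E, d x (g t) = (f t)%:E & d (g s) (g t) = (e s t)%:E].
  move=> s0 st t1; have H := split3 s t s0 st t1.
  have t0 := le_trans s0 st; have H' := split3 t t t0 (lexx t) t1.
  split; rewrite fineK// ge0_fin_numE//; apply: (le_lt_trans _ xy).
  - by apply: le_trans H; rewrite -addeA leeDl// adde_ge0.
  - by apply: le_trans H'; rewrite -addeA leeDl// adde_ge0.
  - by apply: le_trans H; rewrite addeAC leeDr// adde_ge0.
have fE s t : (0 <= s)%R -> (s <= t)%R -> (t <= 1)%R -> e s t = (f t - f s)%R.
  move=> s0 st t1; have := split3 s t s0 st t1.
  have [Es Et E] := gfin s t s0 st t1.
  have := dT x (g s) (g t); rewrite Es Et E -EFinD lee_fin => h1.
  have := dT x (g t) y; rewrite Et.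
  have := d0 (g t) y; rewrite -(fineK dfin); case: (d (g t) y) => [z| |]//= _.
  rewrite -!EFinD !lee_fin => h2 h3; apply/eqP; rewrite eq_le; apply/andP; split; lra.
have f0 : f 0%R = 0%R by rewrite /f gx dxx.
have f1 : f 1%R = fine (d x y) by rewrite /f gy.
(* Continuity of [g] is known on the unit interval; clamping the parameter extends [f] to a
   continuous function on the whole line. *)
pose clamp (t : R) : R := if (t < 0)%R then 0%R else if (1 < t)%R then 1%R else t.
have clamp01 t : (0 <= clamp t)%R /\ (clamp t <= 1)%R.
  by rewrite /clamp; case: (ltP t 0%R) => ?; case: (ltP 1%R t) => ?; split.
have clampK t : (0 <= t <= 1)%R -> clamp t = t.
  by move=> /andP[t0 t1]; rewrite /clamp !ltNge t0 t1.
have clampL s t : (`|clamp s - clamp t| <= `|s - t|)%R.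
  have := ler_norm (s - t); have := ler_norm (t - s); rewrite distrC.
  rewrite ler_norml /clamp; case: (ltP s 0%R) => ?; case: (ltP 1%R s) => ?;
    case: (ltP t 0%R) => ?; case: (ltP 1%R t) => ? ? ?; apply/andP; split; lra.
pose F : R -> R := f \o clamp.
have fcont : continuous F.
  move=> t; apply/cvgrPdist_lt => eps eps0.
  have [c0 c1] := clamp01 t.
  have [|eta eta0 etaP] := gc (clamp t) _ eps eps0; first by rewrite c0.
  apply/nbhs_ballP; exists eta => // s /= ts; have [s0 s1] := clamp01 s.
  have : d (g (clamp s)) (g (clamp t)) < eps%:E.
    apply: etaP; first by rewrite s0.
    by apply: (le_lt_trans (clampL _ _)); rewrite distrC.
  have [st|/ltW {}ts] := leP (clamp s) (clamp t).
    have [_ _ ->] := gfin _ _ s0 st c1; rewrite lte_fin; apply: le_lt_trans.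
    rewrite ler_norml /F /= fE//; have : (0 <= e (clamp s) (clamp t))%R by exact: fine_ge0.
    by rewrite fE// => ?; apply/andP; split; lra.
  rewrite dC; have [_ _ ->] := gfin _ _ c0 ts s1; rewrite lte_fin; apply: le_lt_trans.
  rewrite ler_norml /F /= fE//; have : (0 <= e (clamp t) (clamp s))%R by exact: fine_ge0.
  by rewrite fE// => ?; apply/andP; split; lra.
(* The endpoints are prescribed separately: [f c = 0] does not force [g c = x], since distinct
   points may be at distance 0. *)
have : forall s, exists c, (0 <= s <= 1)%R -> [/\ (0 <= c <= 1)%R,
    f c = (s * fine (d x y))%R, s = 0%R -> c = 0%R & s = 1%R -> c = 1%R].
  move=> s; have [->|s0] := eqVneq s 0%R.
    exists 0%R => _; split => //; rewrite ?lexx ?ler01 ?mul0r//.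
  have [->|s1] := eqVneq s 1%R.
    by exists 1%R => _; split => //; rewrite ?mul1r// lexx ler01.
  have [s01|ns] := boolP (0 <= s <= 1)%R; last first.
    by exists 0%R.
  have /andP[s0' s1'] := s01.
  have [||c c01 fc] := @IVT R F 0%R 1%R (s * fine (d x y))%R ler01.
  - by apply: continuous_subspaceT => ?; exact: fcont.
  - rewrite /F /= !clampK ?lexx ?ler01// f0 f1 ge_min le_max.
    by rewrite mulr_ge0 ?fine_ge0//= ler_piMl ?fine_ge0 ?orbT.
  rewrite in_itv/= in c01; exists c => _; rewrite -fc /F /= clampK//; split => // E.
    by rewrite E eqxx in s0.
  by rewrite E eqxx in s1.
move=> /boolp.choice[tau tauP]; exists (g \o tau); split=> /=.
- by have [|_ _ ->//] := tauP 0%R; rewrite lexx ler01.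
- by have [|_ _ _ ->//] := tauP 1%R; rewrite lexx ler01.
- suff H s t : (0 <= s <= 1)%R -> (0 <= t <= 1)%R -> (tau s <= tau t)%R ->
      d (g (tau s)) (g (tau t)) <= `|s - t|%:E * d x y.
    move=> s t s01 t01; have [st|/ltW ts] := leP (tau s) (tau t); first exact: H.
    by rewrite dC distrC; exact: H.
  move=> /tauP[/andP[c0 c1] fs _ _] /tauP[/andP[c0' c1'] ft _ _] st.
  have [_ _ ->] := gfin _ _ c0 st c1'; rewrite fE// fs ft -(fineK dfin) -EFinM lee_fin.
  by rewrite -mulrBl distrC /=; apply: ler_wpM2r; [exact: fine_ge0|exact: ler_norm].
Qed.

(** The Lipschitz bounds telescope over any partition, which bounds the length from above; the
    partition with one interval bounds it from below. *)
Lemma lipschitz_is_geodesic {R : realType} {T : Type} (S : set T)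
    (eqv : T -> T -> Prop) (D : T -> T -> \bar R) (g : R -> T) :
  (forall a, eqv a a) -> 0 <= D (g 0%R) (g 1%R) < +oo ->
  (forall t, (0 <= t <= 1)%R -> S (g t)) ->
  (forall s t, (0 <= s <= 1)%R -> (0 <= t <= 1)%R ->
     D (g s) (g t) <= `|s - t|%:E * D (g 0%R) (g 1%R)) ->
  is_geodesic S eqv D (g 0%R) (g 1%R) g.
Proof.
move=> eqvxx /andP[D0 Dlty] Sg lip.
have : D (g 0%R) (g 1%R) \is a fin_num by rewrite ge0_fin_numE.
set L := D (g 0%R) (g 1%R) in lip D0 *; move=> /fineK LE; move: (fine L) LE => l LE.
have l0 : (0 <= l)%R by rewrite -lee_fin LE.
split=> //.
(* The added 1 covers [l = 0]. *)
- move=> t t01 e e0; exists (e / (l + 1))%R; first by rewrite divr_gt0// ltr_wpDl.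
  move=> s s01 st; apply: (le_lt_trans (lip s t s01 t01)).
  rewrite -LE -EFinM lte_fin; apply: (@le_lt_trans _ _ (`|s - t| * (l + 1))%R).
    by apply: ler_wpM2l => //; rewrite lerDl.
  by rewrite -ltr_pdivlMr// ltr_wpDl.
- apply/eqP; rewrite eq_le; apply/andP; split; last first.
    apply: ereal_sup_ubound; exists 1%N, (fun n => n%:R%R); split => //.
      by move=> n _; rewrite ler_nat.
    by rewrite big_ord_recr big_ord0 /= add0e.
  apply: ge_ereal_sup => _ [N [t [t0 tN tmono ->]]].
  have mono m n : (m <= n)%N -> (n <= N)%N -> (t m <= t n)%R.
    elim: n => [|n IH]; first by rewrite leqn0 => /eqP ->.
    rewrite leq_eqVlt => /predU1P[-> //|mn] nN.
    by apply: le_trans (tmono _ nN); apply: IH => //; exact: ltnW.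
  have t01 n : (n <= N)%N -> (0 <= t n <= 1)%R.
    by move=> nN; rewrite -t0 -tN !mono.
  apply: (@le_trans _ _ (\sum_(n < N) ((t n.+1 - t n) * l)%:E)).
    apply: lee_sum => n _; have nN := ltn_ord n.
    apply: (le_trans (lip _ _ (t01 _ (ltnW nN)) (t01 _ nN))).
    by rewrite -LE -EFinM lee_fin distrC ger0_norm// subr_ge0 tmono.
  rewrite sumEFin -mulr_suml -(big_mkord xpredT (fun n => t n.+1 - t n)%R).
  by rewrite telescope_sumr// t0 tN subr0 mul1r LE.
Qed.

Lemma fs_equiv_refl {X : Type} (a : fsum X) : fs_equiv a a.
Proof. by exists id; split => // j Jj; exists j. Qed.

(** * Interpolated sums and their membership in the spaces *)

Section interpolation.
Context {R : realType} {X : Type} (d : X -> X -> \bar R) (A : set X).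
Hypotheses (d0 : forall x y, 0 <= d x y) (dxx : forall x, d x x = 0)
  (dC : forall x y, d x y = d y x)
  (dT : forall x y z, d x z <= d x y + d y z)
  (Aclosed : metric_closed d A) (Amin : distance_minimizing d A).

Local Notation dA x := (dist_set d x A).

Lemma finite_off_sum a (P : set nat) (u : nat -> X) (Q : set X) :
  fs_equiv a (off_sum A P u) -> (forall x, Q x -> ~ A x) ->
  finite_set (fs_idx a `&` [set i | Q (fs_pt a i)]) ->
  finite_set (P `&` [set k | Q (u k)]).
Proof.
move=> [f [_ _ fsurj fpt]] QA /(finite_image f); apply: sub_finite_set.
move=> k [Pk Qk]; have [i Ii ik] := fsurj k (conj Pk (QA _ Qk)).
by exists i => //; split => //=; rewrite -fpt// ik.
Qed.

Lemma in_Dbar_off_sum (P : set nat) (w : nat -> X) : in_Dbar A (off_sum A P w).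
Proof. by move=> k []. Qed.

(** A matching with the empty sum sends every point to [A], at a cost no less than its distance to
    [A]; nearest points attain this. Membership for finite exponents thus becomes a summability
    condition. *)
Lemma W_zero_lty r a : (0 < r)%R -> in_Dbar A a ->
  (W d A r%:E (l_delta d A +oo a) (fs_zero a) < +oo) =
  (lpnorm r%:E (fs_idx a `&` [set i | dA (fs_pt a i) < +oo])
     (fun i => dA (fs_pt a i)) < +oo).
Proof.
move=> r0 aA; have p0 : 0 < r%:E by rewrite lte_fin.
have dA0 x : 0 <= dA x by exact: dist_set_ge0.
apply/idP/idP.
  move=> /ereal_inf_lt[_ [m [KI phi0 _ zA _] <-]].
  rewrite matching_costE//; apply: le_lt_trans.
  rewrite -[leRHS]mul1e; apply: (le_lpnorm_inj _ _ _ double) => //.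
  - move=> i [Ii fi]; rewrite m_idxE; left; exists i => //=.
    by split => //; split => //; exact: aA.
  - by move=> k l _ _; exact: double_inj.
  - move=> i [Ii fi]; rewrite mul1e /m_src /m_tgt odd_double doubleK.
    case: ifPn => [/set_mem/phi0//|]; rewrite notin_setE => nK.
    apply: dist_set_le; apply: zA; split => //=.
    by split => //; split => //; exact: aA.
move=> fin; have [nearest nearestP] := exists_nearest d A Amin.
set I := fs_idx a `&` _ in fin *.
apply: (@le_lt_trans _ _ (lpnorm r%:E I
    (fun i => d (fs_pt a i) (nearest (fs_pt a i))))); last first.
  apply: le_lt_trans fin; apply: le_lpnorm => // i [_ /nearestP[_ ->]].
  exact: lexx.
apply: W_le_lpnorm => //.
  exists id; split => [i [Ii []]|//|i [[Ii fi] nA]|//] //=.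
  by exists i.
exists id; split => //= k [[Ik /nearestP[Ak _]] nA] //.
Qed.

Lemma vanishing_in_D a : in_D A a -> vanishing d A a.
Proof. by move=> [_ fa] e _; apply: sub_finite_set fa => i []. Qed.

Lemma vanishing_in_Dbar_p p a : 0 < p -> in_Dbar_p d A p a -> vanishing d A a.
Proof.
case: p => [r| |//] p0 [aA]; last by move=> va e e0; exact: va.
rewrite W_zero_lty//= => -[ufin lfin] e e0.
have := lpnorm_lty_finite r _ _ e p0 e0 _ lfin.
move=> /(_ (fun=> dist_set_ge0 _ _ d0 _)) efin.
have : finite_set (fs_idx (u_delta d A +oo a) `|`
    fs_idx a `&` [set i | dA (fs_pt a i) < +oo] `&` [set i | e%:E <= dA (fs_pt a i)]).
  by rewrite finite_setU.
apply: sub_finite_set => i [Ii /= ei].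
by have [fi|fi] := ltP (dA (fs_pt a i)) +oo; [right|left].
Qed.

Lemma in_Dbar_p_interpolation p a b (P : set nat) (u v w : nat -> X) : 0 < p ->
  in_Dbar_p d A p a -> in_Dbar_p d A p b ->
  fs_equiv a (off_sum A P u) -> fs_equiv b (off_sum A P v) ->
  lpnorm p P (fun k => d (u k) (v k)) < +oo ->
  (p = +oo -> forall k, P k -> d (u k) (v k) <= maxe (dA (u k)) (dA (v k))) ->
  (forall k, P k -> d (u k) (w k) <= d (u k) (v k)) ->
  in_Dbar_p d A p (off_sum A P w).
Proof.
move=> p0 aD bD aP bP Pfin Pmax uw.
have dA0 x : 0 <= dA x by exact: dist_set_ge0.
have wu k : P k -> dA (w k) <= d (u k) (v k) + dA (u k).
  move=> Pk; apply: (le_trans (dist_set_triangle d A d0 dT Amin _ (u k))).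
  by rewrite leeD2r// dC uw.
have nA e x : 0 < e -> e <= dA x -> ~ A x.
  move=> e0 ex Ax; have := dist_set_eq0 d A d0 dxx Aclosed x.
  by rewrite mem_set// gt_eqF// (lt_le_trans e0).
split; first exact: in_Dbar_off_sum.
have va := vanishing_in_Dbar_p p a p0 aD; have vb := vanishing_in_Dbar_p p b p0 bD.
case: p p0 aD bD Pfin Pmax => [r| |//] p0 aD bD Pfin Pmax; last first.
  (* If both ends are within [e / 2] of [A], then [Pmax] makes the pair shorter than [e / 2], and
     [wu] puts [w k] within [e] of [A]. *)
  move=> e e0; have e20 : (0 < e / 2)%R by rewrite divr_gt0.
  have nA2 x : (e / 2)%:E <= dA x -> ~ A x by apply: nA; rewrite lte_fin.
  have := finite_off_sum a P u [set x | (e / 2)%:E <= dA x] aP nA2 (va _ e20).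
  have := finite_off_sum b P v [set x | (e / 2)%:E <= dA x] bP nA2 (vb _ e20).
  move=> fv fu; have : finite_set ((P `&` [set k | (e / 2)%:E <= dA (u k)]) `|`
    (P `&` [set k | (e / 2)%:E <= dA (v k)])) by rewrite finite_setU.
  apply: sub_finite_set => k /= [[Pk _] ek].
  have [ue|ue] := leP (e / 2)%:E (dA (u k)); first by left.
  have [ve|ve] := leP (e / 2)%:E (dA (v k)); first by right.
  have : d (u k) (v k) < (e / 2)%:E.
    by apply: le_lt_trans (Pmax erefl k Pk) _; rewrite gt_max ue.
  move=> /lteD /(_ ue); rewrite -EFinD -splitr => h.
  by have := le_lt_trans (le_trans ek (wu k Pk)) h; rewrite ltxx.
have [aA []] := aD; rewrite W_zero_lty// => ufin lfin.
have uvfin k : P k -> d (u k) (v k) < +oo.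
  move=> Pk; apply: le_lt_trans Pfin.
  exact: (@le_lpnorm_pt _ _ _ _ (fun k => d (u k) (v k))).
split.
  have := finite_off_sum a P u [set x | +oo <= dA x] aP (nA +oo ^~ (ltry 0)) ufin.
  apply: sub_finite_set => k /= [[Pk _] wk]; split=> //=.
  rewrite leNgt; apply/negP => uk.
  have := le_lt_trans (le_trans wk (wu k Pk)) (lte_add_pinfty (uvfin k Pk) uk).
  by rewrite ltxx.
rewrite W_zero_lty//; last exact: in_Dbar_off_sum.
set S := _ `&` _.
have SP : S `<=` P by move=> k [[]].
apply: (@le_lt_trans _ _ (lpnorm r%:E S (fun k => d (u k) (v k) + dA (u k)))).
  apply: le_lpnorm => //; first by move=> k; exact: adde_ge0.
  by move=> k /SP; exact: wu.
apply: lpnorm_ltyD => //.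
  apply: le_lt_trans Pfin; rewrite -[leRHS]mul1e.
  by apply: (le_lpnorm_inj _ _ _ id) => // k; rewrite mul1e.
(* Indices with [u k] in [A] correspond to no point of [a], but they contribute 0; once they are
   removed, the rest injects into the indices of [a]. *)
rewrite -lpnorm_support//; apply: le_lt_trans lfin; rewrite -[leRHS]mul1e.
have [f [fP finj fsurj fpt]] := aP; rewrite /off_sum in fP fsurj fpt.
have : forall k, exists i, P k -> ~ A (u k) -> fs_idx a i /\ f i = k.
  move=> k; have [[Pk nAk]|n] := pselect (P k /\ ~ A (u k)).
    by have [i Ii ik] := fsurj k (conj Pk nAk); exists i.
  by exists 0%N => Pk nAk; case: n.
move=> /boolp.choice[g gP].
have gP' k : (S `&` [set k | dA (u k) != 0]) k -> fs_idx a (g k) /\ f (g k) = k.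
  move=> [/SP Pk /= uk]; apply: gP => // Au; move: uk.
  by rewrite dist_set_eq0// mem_set.
have uE k : (S `&` [set k | dA (u k) != 0]) k -> u k = fs_pt a (g k).
  by move=> /gP'[Ig gk]; rewrite -fpt// gk.
apply: (le_lpnorm_inj _ _ _ g) => //.
- move=> k Sk; have [Ig _] := gP' k Sk; split => //=; rewrite -uE//.
  case: Sk => -[[Pk _] /= wk] _.
  apply: (le_lt_trans (dist_set_triangle d A d0 dT Amin _ (w k))).
  by apply: lte_add_pinfty => //; exact: (le_lt_trans (uw k Pk) (uvfin k Pk)).
- by move=> k l /gP'[_ {2}<-] /gP'[_ {2}<-] ->.
- by move=> k Sk; rewrite mul1e uE.
Qed.

Lemma interpolation p a b : geodesic_space setT (@eq X) d -> 0 < p ->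
  in_Dbar A a -> in_Dbar A b -> vanishing d A a -> vanishing d A b ->
  W d A p a b < +oo ->
  exists g : R -> fsum X, [/\ g 0%R = a, g 1%R = b,
    forall s t, (0 <= s <= 1)%R -> (0 <= t <= 1)%R ->
      W d A p (g s) (g t) <= `|s - t|%:E * W d A p a b,
    in_D A a -> in_D A b -> forall t, (0 <= t <= 1)%R -> in_D A (g t) &
    in_Dbar_p d A p a -> in_Dbar_p d A p b ->
      forall t, (0 <= t <= 1)%R -> in_Dbar_p d A p (g t)].
Proof.
move=> geo p0 aA bA va vb Wfin.
have [P [u [v [aP bP PW Pfin Pmax]]]] :=
  optimal_pairing d A d0 dxx dC dT Aclosed Amin p a b p0 aA bA va vb Wfin.
have uvfin k : P k -> d (u k) (v k) < +oo.
  move=> Pk; apply: le_lt_trans Wfin; apply: le_trans PW.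
  exact: (@le_lpnorm_pt _ _ _ _ (fun k => d (u k) (v k))).
have /boolp.choice[h hP] : forall k, exists h : R -> X, [/\ h 0%R = u k,
    h 1%R = v k & P k -> forall s t, (0 <= s <= 1)%R -> (0 <= t <= 1)%R ->
      d (h s) (h t) <= `|s - t|%:E * d (u k) (v k)].
  move=> k; have [/uvfin Pk|nPk] := pselect (P k).
    have dm : is_metric d by split.
    by have [h [h0 h1 hL]] := constant_speed_geodesic d dm geo _ _ Pk; exists h.
  by exists (fun t => if t == 0%R then u k else v k); rewrite eqxx oner_eq0; split.
(* At the endpoints [off_sum] recovers [a] and [b] only up to reindexing; returning them literally
   makes the distance between [g 0] and [g 1] equal to [W d A p a b] by rewriting. *)
pose g t := if t == 0%R then a else if t == 1%R then b
  else off_sum A P (fun k => h k t).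
have gP t : fs_equiv (g t) (off_sum A P (fun k => h k t)).
  rewrite /g; case: eqP => [->|_].
    by under [fun k => h k _]eq_fun => k do (have [-> _ _] := hP k; over).
  case: eqP => [->|_]; last exact: fs_equiv_refl.
  by under [fun k => h k _]eq_fun => k do (have [_ -> _] := hP k; over).
exists g; split.
- by rewrite /g eqxx.
- by rewrite /g oner_eq0 eqxx.
- move=> s t s01 t01; apply: (le_trans (W_le_lpnorm d d0 A p _ _ P _ _ p0 (gP s) (gP t))).
  apply: (@le_trans _ _ (`|s - t|%:E * lpnorm p P (fun k => d (u k) (v k)))).
    apply: (le_lpnorm_inj _ _ _ id) => // k Pk.
    by have [_ _ ->] := hP k.
  by apply: lee_wpmul2l => //; rewrite lee_fin.
- move=> aD bD t _; rewrite /g; case: eqP => // _; case: eqP => // _; split.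
    exact: in_Dbar_off_sum.
  by apply: sub_finite_set (Pfin aD.2 bD.2) => k [].
- move=> aD bD t t01; rewrite /g; case: eqP => // _; case: eqP => // _.
  apply: (in_Dbar_p_interpolation p a b P u v) => //; first exact: le_lt_trans Wfin.
  move=> k Pk /=; have [hk0 _ hL] := hP k; rewrite -{1}hk0.
  apply: (le_trans (hL Pk 0%R t _ t01)); first by rewrite lexx ler01.
  rewrite sub0r normrN -[leRHS]mul1e; apply: lee_wpmul2r => //.
  by rewrite lee_fin ger0_norm; case/andP: t01.
Qed.

End interpolation.

Theorem theorem5p9 (R : realType) (X : Type) (d : X -> X -> \bar R) (A : set X)
  (p : \bar R) :
  metric_pair d A -> @geodesic_space R X setT (@eq X) d -> distance_minimizing d A ->
  1 <= p ->
  @geodesic_space R (fsum X) (in_Dbar_p d A p) fs_equiv (W d A p) /\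
  @geodesic_space R (fsum X) (in_D A) fs_equiv (W d A p).
Proof.
move=> [[d0 [dxx [dC dT]]] Aclosed] geo Amin p1.
have p0 : 0 < p by exact: lt_le_trans p1.
split=> a b aD bD ab.
  have [g [g0 g1 gL _ gD]] := interpolation d A d0 dxx dC dT Aclosed Amin p a b geo p0
    aD.1 bD.1 (vanishing_in_Dbar_p d A d0 Amin p a p0 aD)
    (vanishing_in_Dbar_p d A d0 Amin p b p0 bD) ab.
  exists g; rewrite -g0 -g1 in ab gL *; apply: lipschitz_is_geodesic => //.
  - exact: fs_equiv_refl.
  - by rewrite W_ge0.
  - exact: gD.
have [g [g0 g1 gL gD _]] := interpolation d A d0 dxx dC dT Aclosed Amin p a b geo p0
  aD.1 bD.1 (vanishing_in_D d A a aD) (vanishing_in_D d A b bD) ab.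
exists g; rewrite -g0 -g1 in ab gL *; apply: lipschitz_is_geodesic => //.
- exact: fs_equiv_refl.
- by rewrite W_ge0.
- exact: gD.
Qed.
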